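(* Assume Martin's Maximum ($\mathsf{MM}$). Let $f:[\omega_2]^2\to\omega_2$ be a normal coloring for which there is an ordinal $\gamma<\omega_1$ such that for all $\alpha<\beta<\omega_2$ the set $t_{\alpha\beta}=\{\xi<\beta: f(\{\xi,\beta\})=f(\{\alpha,\beta\})\}$ has order type at most $\gamma$. Then there exists a closed $f$-rainbow set $A\subseteq\omega_2$ of order type $\omega_1$. (That is, $\mathsf{MM}$ implies $\omega_2\to^{\mathrm{poly}}(\omega_1\text{-}cl)^2_{<\omega_1\text{-}t\text{-}bdd}$.)
   Context: $[C]^2$ is the set of two-element subsets of $C$. A coloring $f$ on $[C]^2$, with $C$ a set of ordinals, is normal if $f(a)=f(b)$ implies $\max a=\max b$. A set $A\subseteq C$ is $f$-rainbow if $f\restriction[A]^2$ is one-to-one. A set $A$ of ordinals is closed if whenever $\sup(A\cap\alpha)=\alpha<\sup A$ (with $\alpha$ a limit ordinal), then $\alpha\in A$, i.e. $A$ is closed in its supremum. Martin's Maximum is the statement that for every forcing notion that preserves stationary subsets of $\omega_1$ and every family of $\aleph_1$ many dense subsets of it, there is a filter meeting all of them. *)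

(* Defs.v *)
From mathcomp Require Import all_boot all_order.
From mathcomp Require Import boolp classical_sets functions cardinality.
Set Implicit Arguments.
Unset Strict Implicit.
Unset Printing Implicit Defensive.
Import Order.TTheory.
Local Open Scope order_scope.
Local Open Scope classical_set_scope.
Local Open Scope card_scope.

(* An ordinal is represented by a well-ordered type: its elements are the      *)
(* smaller ordinals.  The cardinals omega_1 and omega_2 are pinned down up to  *)
(* (unique) order isomorphism as successor cardinals: [is_succ_cardinal K W]   *)
(* says that W is the least ordinal that does not inject into K.               *)

Definition init_seg d (W : orderType d) (a : W) : set W := [set x | x < a].

Definition is_succ_cardinal (K : Type) d (W : orderType d) : Prop :=
  [/\ well_founded (fun x y : W => x < y),
      (forall a : W, init_seg a #<= [set: K])
    & ~ ([set: W] #<= [set: K])].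

Definition is_omega1 d (W : orderType d) : Prop := is_succ_cardinal nat W.

Definition is_omega2 d1 (W1 : orderType d1) d2 (W2 : orderType d2) : Prop :=
  is_omega1 W1 /\ is_succ_cardinal W1 W2.

Definition same_otp d (W : orderType d) (A : set W)
    d' (W' : orderType d') (B : set W') : Prop :=
  exists h : W -> W', set_bij A B h /\ {in A &, {mono h : x y / x < y}}.

(* gamma < omega_1 is given as an element of W1, so its underlying set of      *)
(* smaller ordinals is [init_seg gamma].                                       *)
Definition otp_le d (W : orderType d) (A : set W)
    d1 (W1 : orderType d1) (gamma : W1) : Prop :=
  exists2 delta : W1, delta <= gamma & same_otp A (init_seg delta).

Definition is_limit d (W : orderType d) (a : W) : Prop :=
  (exists b, b < a) /\ (forall b, b < a -> exists2 c, b < c & c < a).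

(* The supremum of A is taken among all ordinals, and may be the order type of *)
(* W itself; a < sup A means that a is below some element of A.                *)
Definition closed_ord d (W : orderType d) (A : set W) : Prop :=
  forall a : W, is_limit a -> isLub (A `&` init_seg a) a ->
    (exists2 b, A b & a < b) -> A a.

Definition unbounded d (W : orderType d) (A : set W) : Prop :=
  forall a : W, exists2 b, A b & a < b.

Definition club d (W : orderType d) (C : set W) : Prop :=
  closed_ord C /\ unbounded C.

Definition stationary d (W : orderType d) (S : set W) : Prop :=
  forall C : set W, club C -> S `&` C !=set0.

Section Forcing.
Variables (P : Type) (le : P -> P -> Prop).

(* Smaller conditions are stronger. *)
Definition forcing_notion : Prop :=
  [/\ inhabited P, (forall p, le p p)
    & (forall p q r, le p q -> le q r -> le p r)].

Definition dense (D : set P) : Prop := forall p, exists2 q, D q & le q p.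

Definition dense_below (p : P) (D : set P) : Prop :=
  forall q, le q p -> exists2 r, D r & le r q.

Definition is_filter (G : set P) : Prop :=
  [/\ G !=set0, (forall p q, G p -> le p q -> G q)
    & (forall p q, G p -> G q -> exists r, [/\ G r, le r p & le r q])].

(* A sentence of the forcing language is identified with the set of conditions *)
(* forcing it; the connectives below are the usual recursive clauses of the    *)
(* forcing relation.  Quantifiers range over ground-model elements.            *)
Definition f_and (phi psi : set P) : set P := [set p | phi p /\ psi p].

Definition f_imp (phi psi : set P) : set P :=
  [set p | forall q, le q p -> phi q -> psi q].

Definition f_all (I : Type) (D : set I) (phi : I -> set P) : set P :=
  [set p | forall i, D i -> phi i p].

Definition f_ex (I : Type) (D : set I) (phi : I -> set P) : set P :=
  [set p | dense_below p [set q | exists2 i, D i & phi i q]].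

Variables (d1 : Order.disp_t) (W1 : orderType d1).

(* A nice name for a subset of omega_1: the name {(a^, p) | p \in N a}.        *)
(* Every subset of omega_1 in a generic extension has a nice name.             *)
Definition nice_name : Type := W1 -> set P.

Definition f_mem (a : W1) (N : nice_name) : set P :=
  [set p | dense_below p [set q | exists2 r, N a r & le q r]].

Definition f_unbounded (N : nice_name) : set P :=
  f_all setT (fun a => f_ex [set b | a < b] (fun b => f_mem b N)).

(* sup (N `&` a) = a, i.e. no b < a is an upper bound of N `&` a *)
Definition f_sup_below (N : nice_name) (a : W1) : set P :=
  f_all (init_seg a)
    (fun b => f_ex [set c | b < c /\ c < a] (fun c => f_mem c N)).

Definition f_closed (N : nice_name) : set P :=
  f_all [set a | is_limit a] (fun a => f_imp (f_sup_below N a) (f_mem a N)).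

Definition f_club (N : nice_name) : set P :=
  f_and (f_closed N) (f_unbounded N).

(* Every condition forces that the check name of S is stationary in the        *)
(* ground-model omega_1.  If omega_1 were collapsed, the extension would have  *)
(* a cofinal omega-sequence of successor ordinals in it, which is a club       *)
(* missing the stationary set of limit ordinals; so omega_1 is preserved.      *)
Definition f_stationary (S : set W1) : set P :=
  [set p | forall N : nice_name,
     f_imp (f_club N) (f_ex S (fun a => f_mem a N)) p].

Definition preserves_stationary : Prop :=
  forall S : set W1, stationary S -> forall p, f_stationary S p.

End Forcing.

Definition Martins_Maximum d1 (W1 : orderType d1) : Prop :=
  forall (P : Type) (le : P -> P -> Prop),
    forcing_notion le -> preserves_stationary le W1 ->
    forall D : W1 -> set P, (forall i, dense le (D i)) ->
      exists2 G : set P, is_filter le G & forall i, G `&` D i !=set0.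

Section Colorings.
Variables (d : Order.disp_t) (W : orderType d).

(* [C]^2 *)
Definition pairs (C : set W) : set (set W) :=
  [set a | exists x y, [/\ C x, C y, x != y & a = [set x; y]]].

Definition is_max (a : set W) (m : W) : Prop := a m /\ ubound a m.

(* A coloring on [C]^2 is given as a function on all sets of ordinals, only    *)
(* its values on [C]^2 being relevant.                                         *)
Definition normal_coloring (T : Type) (C : set W) (f : set W -> T) : Prop :=
  forall a b, pairs C a -> pairs C b -> f a = f b ->
  forall m n, is_max a m -> is_max b n -> m = n.

Definition rainbow (T : Type) (f : set W -> T) (A : set W) : Prop :=
  set_inj (pairs A) f.

Definition t_set (T : Type) (f : set W -> T) (a b : W) : set W :=
  [set x | x < b /\ f [set x; b] = f [set a; b]].

End Colorings.

(* Main.v *)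
From Stdlib Require List.
Require Import Defs.
From mathcomp Require Import all_boot all_order.
From mathcomp Require Import boolp classical_sets functions cardinality.
Set Implicit Arguments.
Unset Strict Implicit.
Unset Printing Implicit Defensive.
Import Order.TTheory.
Local Open Scope order_scope.
Local Open Scope classical_set_scope.

(** Write [c(x,z)] for [f {x,z}].  By normality a set [A] is rainbow as soon as,
    for every [z] in [A], the map [c(.,z)] is injective on the elements of [A]
    below [z]; say then that those elements are free below [z].

    Martin's Maximum is applied to a forcing with finite conditions.  A
    condition is a finite [\in]-chain of countable models, each one marked by
    its peak, the supremum of its [omega_2]-part; the generic set consists of
    the peaks.  Three clauses are put on conditions.  Each model carries a
    decoration, an ordinal of the next model, which the peaks of all higher
    models must exceed; this makes the generic set closed.  The peaks form a
    rainbow set.  And the set of [z] below which the peaks are free is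
    stationary in [omega_2] among the points of cofinality [omega] ([large]):
    without this clause a condition might have no extension at all, as when
    [c(0,z) = c(1,z)] for every [z].

    The forcing preserves a stationary [T].  Given a condition [q], a large set
    of candidates [z] and a name for a club, there is a countable model [M],
    closed under Skolem functions for the name, whose [omega_1]-part is some
    [delta] in [T] and whose peak is one of the candidates ([model_exists]);
    [M] can be chosen so that [q] with [M] on top is again a condition
    ([add_top]).  That condition forces [delta] into the club because it is
    [M]-generic ([reflect_below]): let [r] be below it and in a dense set of
    [M].  The part of [r] below [M] belongs to [M].  The peaks of the models of
    [r] from [M] on form a branch through a tree of finite sequences that lies
    in [M], and since these models are elementary and increasing, the tree has
    unboundedly many successors at each of its nodes along the way.  Hence a
    new branch can be found inside [M] by choosing its points one by one.  A
    point must avoid finitely many classes [t_{xy}], so it must avoid finitely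
    many sets of order type at most [gamma]; by [short_avoid] such sets never
    exhaust the first [rho] terms of an increasing [omega_1]-sequence, for a
    [rho] depending on [gamma] only, and [rho] belongs to [M].  This is where
    the uniform bound [gamma] is used.  Largeness survives by the pigeonhole
    principle: every [z] in a large set admits a suitable branch in [M], there
    are countably many branches, so one branch suits a large set of [z].

    The filter obtained yields an [\in]-chain of models.  The [omega_1]-parts
    of the models are unbounded in [omega_1] and increase with the peaks,
    whence the order type.  If a limit of peaks were not a peak, the next model
    above it would contain an ordinal between that limit and its own peak;
    genericity puts such an ordinal as a decoration on some lower model,
    and no peak could lie between that model and the limit. *)

(** * Covering by a cardinal, and transfinite recursion *)

(** Well-founded recursion for a choice constrained by a relation [P i h x],
    where [x] is the value at [i] and [h] matters only below [i]. *)
Lemma wf_choice I (R : I -> I -> Prop) (T : Type) (t0 : T)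
    (P : I -> (I -> T) -> T -> Prop) :
  well_founded R ->
  (forall i h h' x, (forall j, R j i -> h j = h' j) -> P i h x -> P i h' x) ->
  (forall i h, exists x, P i h x) ->
  exists h, forall i, P i h (h i).
Proof.
move=> wfR extP exP.
have [g gP] := choice (fun ih : I * (I -> T) => exP ih.1 ih.2).
pose ext i (rec : forall j, R j i -> T) j :=
  if pselect (R j i) is left r then rec j r else t0.
pose F i rec := g (i, ext i rec).
pose h := Fix wfR (fun=> T) F.
have hE i : h i = F i (fun j _ => h j).
  apply: (Fix_eq wfR (fun=> T) F) => j r r' rr'.
  by congr (F j _); apply: functional_extensionality_dep => k;
    apply: functional_extensionality_dep => kj; exact: rr'.
exists h => i; rewrite [X in P _ _ X]hE; apply: extP (gP (i, _)) => j ji /=.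
by rewrite /ext; case: pselect.
Qed.

Lemma wf_least T (R : T -> T -> Prop) (A : set T) : well_founded R ->
  A !=set0 -> exists2 x, A x & forall y, A y -> ~ R y x.
Proof.
move=> wfR [x]; elim/(well_founded_ind wfR): x => x IH Ax.
case: (pselect (exists2 y, A y & R y x)) => [[y Ay yx]|no].
  exact: IH yx Ay.
by exists x => // y Ay yx; apply: no; exists y.
Qed.

(** Cardinality at most [K], phrased with a surjection because this makes unions
    immediate. *)
Definition covers K T (A : set T) :=
  exists v : K -> T, forall x, A x -> exists k, v k = x.

Lemma covers_sub K T (A B : set T) : A `<=` B -> covers K B -> covers K A.
Proof. by move=> AB [v vP]; exists v => x /AB; exact: vP. Qed.

Lemma covers_bigU K I T (A : I -> set T) :
  covers K [set: K * K] -> covers K [set: I] ->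
  (forall i, covers K (A i)) -> covers K [set x | exists i, A i x].
Proof.
move=> [p pP] [s sP] /choice[v vP].
exists (fun k => v (s (p k).1) (p k).2) => x [i /vP[k2 <-]].
have [k1 <-] := sP i Logic.I; have [k kE] := pP (k1, k2) Logic.I.
by exists k; rewrite kE.
Qed.

Lemma covers_image K T U (A : set T) (g : T -> U) :
  covers K A -> covers K (g @` A).
Proof.
move=> [v vP]; exists (g \o v) => _ [x /vP[k <-] <-].
by exists k.
Qed.

Lemma covers_trans K L T (A : set T) :
  covers K [set: L] -> covers L A -> covers K A.
Proof.
move=> [u uP] [v vP]; exists (v \o u) => x /vP[l <-].
by have [k <-] := uP l Logic.I; exists k.
Qed.

Lemma covers_id K : covers K [set: K].
Proof. by exists id => x _; exists x. Qed.

Lemma covers_inj K T U (x0 : T) (A : set T) (B : set U) (g : T -> U) :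
  {in A &, injective g} -> (forall x, A x -> B (g x)) ->
  covers K B -> covers K A.
Proof.
move=> gi gB [v vP].
pose w k := if pselect (exists2 x, A x & g x = v k) is left e then s2val (cid2 e)
            else x0.
exists w => x Ax; have [k kE] := vP _ (gB _ Ax); exists k; rewrite /w.
case: pselect => [e|[]]; last by exists x.
by case: (cid2 e) => y Ay /= gy; apply: gi; rewrite ?inE // gy.
Qed.

Lemma covers_prod K S T : covers K [set: K * K] ->
  covers K [set: S] -> covers K [set: T] -> covers K [set: S * T].
Proof.
move=> [p pP] [s sP] [t tP]; exists (fun k => (s (p k).1, t (p k).2)).
move=> [x y] _; have [i <-] := sP x Logic.I; have [j <-] := tP y Logic.I.
by have [k kE] := pP (i, j) Logic.I; exists k; rewrite kE.
Qed.

(** The two facts about an infinite cardinal on which all counting below rests. *)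
Definition pairing K := covers K [set: K * K] /\ covers K [set: nat].

Lemma covers_countType K (T : countType) (x0 : T) :
  pairing K -> covers K [set: T].
Proof.
move=> [_ KN]; apply: covers_trans KN _.
exists (fun n => odflt x0 (unpickle n)) => x _; exists (pickle x).
by rewrite pickleK.
Qed.

Lemma pairing_nat : pairing nat.
Proof.
split; last exact: covers_id.
exists (fun n => odflt (0, 0)%N (unpickle n)) => x _.
by exists (pickle x); rewrite pickleK.
Qed.

Lemma coversU K T (A B : set T) : pairing K ->
  covers K A -> covers K B -> covers K (A `|` B).
Proof.
move=> pK cA cB.
apply: (@covers_sub _ _ _ [set x | exists b : bool, (if b then A else B) x]).
  by move=> x [?|?]; [exists true|exists false].
apply: covers_bigU pK.1 _ _; first exact: covers_countType true pK.
by case.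
Qed.

(** * Successor cardinals *)

Section SuccCard.
Variables (K : Type) (d : Order.disp_t) (W : orderType d).
Hypothesis hW : is_succ_cardinal K W.
Hypothesis pK : pairing K.

Lemma succ_card_wf : well_founded (fun x y : W => x < y).
Proof. by case: hW => wf _ _; exact: wf. Qed.

Lemma succ_card_inhabited : inhabited W.
Proof.
case: hW => _ _ h; apply: contrapT => e; apply: h.
have [v vP] := pK.2; have [k _] := vP 0%N Logic.I.
have /injfunPex[f] : exists2 f : W -> K, set_fun setT setT f & set_inj setT f.
  by exists (fun=> k) => // x y; case: e.
exact: inj_card_le.
Qed.

Lemma succ_card_init (a : W) : covers K (init_seg a).
Proof.
case: hW => _ /(_ a)/card_leP[g] _.
case: (pselect (init_seg a !=set0)) => [[b ba]|no]; last first.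
  by exists (fun=> a) => x xa; case: no; exists x.
have cg : covers K [set: init_seg a].
  apply: (@covers_inj _ _ _ (exist _ b (mem_set ba)) _ setT
    (fun x => val (g x))) (covers_id K) => //.
  by move=> x y _ _ /val_inj; apply: inj; rewrite inE.
apply: covers_sub (covers_image val cg) => x xa.
by exists (exist _ x (mem_set xa)).
Qed.

Lemma succ_card_ncovers : ~ covers K [set: W].
Proof.
case: hW => _ _ h [v vP]; apply: h.
have [g gP] := choice (fun x => vP x Logic.I).
have /injfunPex[f] : exists2 f : W -> K, set_fun setT setT f & set_inj setT f.
  exists g => // x y _ _ gxy; by rewrite -(gP x) gxy gP.
exact: inj_card_le.
Qed.

(** Regularity of [K^+]: an unbounded [u] would make [W] a union of [K] initial
    segments, each of size at most [K]. *)
Lemma succ_card_bounded (u : K -> W) : exists b, forall k, u k < b.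
Proof.
apply: contrapT => nb; apply: succ_card_ncovers.
apply: (@covers_sub _ _ _ [set x | exists k, (init_seg (u k) `|` [set u k]) x]).
  move=> x _; apply: contrapT => nx; apply: nb; exists x => k.
  rewrite ltNge le_eqVlt; apply/negP => /orP[/eqP xu|xu]; apply: nx; exists k.
    by right.
  by left.
apply: covers_bigU => [|| k]; [exact: pK.1 | exact: covers_id |].
apply: coversU => //; first exact: succ_card_init.
by exists (fun=> u k) => x /= ->; exists k.
Qed.

Lemma succ_card_bounded_set (A : set W) : covers K A ->
  exists b, forall x, A x -> x < b.
Proof.
by move=> [v vP]; have [b bP] := succ_card_bounded v; exists b => x /vP[k <-].
Qed.

(** At stage [i] the values [nx (u j)], [j < i], are at most [K] in number,
    hence bounded, and [Q i] has elements above the bound. *)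
Lemma transfinite_seq d' (I : orderType d') (Q : I -> W -> Prop) (nx : W -> W) :
  well_founded (fun i j : I => i < j) ->
  (forall i : I, covers K (init_seg i)) ->
  (forall i, unbounded (Q i)) ->
  exists u : I -> W,
    (forall i, Q i (u i)) /\ (forall i j, j < i -> nx (u j) < u i).
Proof.
move=> wfI cI unb.
have [w0] := succ_card_inhabited.
pose P i (h : I -> W) x := Q i x /\ forall j, j < i -> nx (h j) < x.
have [||u uP] := @wf_choice I (fun i j => i < j) W w0 P wfI.
- by move=> i h h' x hh [Qx hx]; split=> // j ji; rewrite -hh //; exact: hx.
- move=> i h.
  have [b bP] := succ_card_bounded_set (covers_image (nx \o h) (cI i)).
  have [x Qx bx] := unb i b; exists x; split=> // j ji.
  by apply: lt_trans bx; apply: bP; exists j.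
by exists u; split=> [i|i]; case: (uP i).
Qed.

Lemma succ_card_gt (a : W) : exists b, a < b.
Proof.
have [v vP] := pK.2; have [k _] := vP 0%N Logic.I.
by have [b /(_ k)] := succ_card_bounded (fun=> a); exists b.
Qed.

Lemma increasing_limit (e : nat -> W) : (forall n, e n < e n.+1) ->
  exists a, (forall n, e n < a) /\ (forall x, x < a -> exists n, x < e n).
Proof.
move=> e_incr.
have [b bP] := succ_card_bounded_set
  (covers_image e (covers_trans pK.2 pairing_nat.2)).
have [] := @wf_least _ _ [set a | forall n, e n < a] succ_card_wf.
  by exists b => n; apply: bP; exists n.
move=> a aP amin; exists a; split=> // x xa; apply: contrapT => no.
apply: (amin x) => // n; apply: lt_le_trans (e_incr n) _.
by rewrite leNgt; apply/negP => ?; apply: no; exists n.+1.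
Qed.

End SuccCard.

(** * The first uncountable ordinal *)

Section Omega1.
Variables (d : Order.disp_t) (W1 : orderType d).
Hypothesis h1 : is_omega1 W1.

Let wf1 : well_founded (fun x y : W1 => x < y) := succ_card_wf h1.
Let init1 (i : W1) : covers nat (init_seg i) := succ_card_init h1 i.

(** [W1] contains [omega]-blocks [{iter n S (b i) | n}], one above the other and
    indexed by [i : W1]. *)
Lemma omega1_covers_nat : covers W1 [set: W1 * nat].
Proof.
have [S SP] := choice (succ_card_gt h1 pairing_nat).
have [nx nxP] := choice (fun a => succ_card_bounded h1 pairing_nat
  (fun n => iter n S a)).
have unbT (_ : W1) : unbounded [set: W1].
  by move=> a; exists (S a).
have [b [_ bP]] := transfinite_seq h1 pairing_nat nx wf1 init1 unbT.
have Sh i : {homo (fun n => iter n S (b i)) : m n / (m < n)%N >-> m < n}.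
  move=> m; elim=> // n IH; rewrite ltnS leq_eqVlt => /orP[/eqP->|/IH].
    exact: SP.
  by move=> /lt_trans; apply; exact: SP.
have lt_b i j m n : i < j -> iter m S (b i) < iter n S (b j).
  move=> ij; apply: lt_le_trans (nxP _ m) _; apply: le_trans (ltW (bP _ _ ij)) _.
  by case: n => // n; apply/ltW/(Sh j 0%N n.+1).
have [w0] := succ_card_inhabited h1 pairing_nat.
apply: (@covers_inj _ _ _ (w0, 0%N) _ setT (fun p => iter p.2 S (b p.1)))
  (covers_id W1) => //.
move=> [i m] [j n] _ _ /= E.
have [ij|ji|ij] := ltgtP i j.
- by move: (lt_b _ _ m n ij); rewrite E ltxx.
- by move: (lt_b _ _ n m ji); rewrite E ltxx.
- subst j; congr (_, _); have [mn|nm|//] := ltngtP m n.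
    by move: (Sh i _ _ mn); rewrite E ltxx.
  by move: (Sh i _ _ nm); rewrite E ltxx.
Qed.

(** The pairs below [m] form a countable set, so [m] and a natural number
    determine a pair. *)
Lemma pairing_omega1 : pairing W1.
Proof.
have c1 := omega1_covers_nat; split.
  have [v vP] := choice init1.
  have [nx nxP] := choice (succ_card_gt h1 pairing_nat).
  have [w wP] := pairing_nat.1.
  apply: covers_trans c1 _.
  exists (fun p => (v p.1 (w p.2).1, v p.1 (w p.2).2)) => -[i j] _.
  pose m := nx (Order.max i j).
  have im : i < m by apply: le_lt_trans (nxP _); rewrite le_max lexx.
  have jm : j < m by apply: le_lt_trans (nxP _); rewrite le_max lexx orbT.
  have [k kE] := vP m _ im; have [l lE] := vP m _ jm.
  have [n nE] := wP (k, l) Logic.I.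
  by exists (m, n); rewrite /= nE /= kE lE.
apply: covers_sub (covers_image snd c1) => n _.
by have [w0] := succ_card_inhabited h1 pairing_nat; exists (w0, n).
Qed.

(** The isomorphism [h] sends [x] to the least element above all [h z],
    [z < x].  The map [g] dominates [h], so that the recursion never runs out of
    values, and it makes [A] uncountable, so that [h] is onto. *)
Lemma same_otp_omega1 d' (W : orderType d') (A : set W) (g : W -> W1) :
  well_founded (fun x y : W => x < y) ->
  {in A &, {homo g : x y / x < y}} -> (forall i, exists2 x, A x & i <= g x) ->
  same_otp A [set: W1].
Proof.
move=> wf gA gu; have [w0] := succ_card_inhabited h1 pairing_nat.
pose above (h : W -> W1) x y := forall z, A z -> z < x -> h z < y.
pose P x h y := A x -> above h x y /\ forall y', above h x y' -> y <= y'.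
have g_inj : {in A &, injective g}.
  move=> x y Ax Ay E; have [xy|yx|//] := ltgtP x y.
    by have := gA _ _ Ax Ay xy; rewrite E ltxx.
  by have := gA _ _ Ay Ax yx; rewrite E ltxx.
have [||h hP] := @wf_choice _ _ _ w0 P wf.
- move=> x h h' y hh Px /Px[a b]; split=> [z Az zx|y' y'P].
    by rewrite -hh //; exact: a.
  by apply: b => z Az zx; rewrite hh //; exact: y'P.
- move=> x h; case: (pselect (A x)) => [Ax|]; last by exists w0.
  have cA : covers nat [set z | A z /\ z < x].
    apply: (@covers_inj _ _ _ x _ _ g _ _ (init1 (g x))).
      by move=> y z /set_mem[Ay _] /set_mem[Az _]; apply: g_inj; rewrite inE.
    by move=> z [Az zx]; apply: gA; rewrite ?inE.
  have [b bP] := succ_card_bounded_set h1 pairing_nat (covers_image h cA).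
  have [] := @wf_least _ _ (above h x) wf1.
    by exists b => z Az zx; apply: bP; exists z.
  move=> y yP ymin; exists y => _; split=> // y' /ymin.
  by case: leP.
have h_mono x z : A x -> A z -> z < x -> h z < h x.
  by move=> Ax Az; case: (hP x Ax) => + _; apply.
have h_le x : A x -> h x <= g x.
  elim/(well_founded_ind wf): x => x IH Ax; case: (hP x Ax) => _; apply=> z Az zx.
  by apply: le_lt_trans (IH _ zx Az) _; apply: gA; rewrite ?inE.
have h_inj : {in A &, injective h}.
  move=> x y /set_mem Ax /set_mem Ay E; have [xy|yx|//] := ltgtP x y.
    by have := h_mono _ _ Ay Ax xy; rewrite E ltxx.
  by have := h_mono _ _ Ax Ay yx; rewrite E ltxx.
exists h; split; last first.
  move=> x y /set_mem Ax /set_mem Ay; apply/idP/idP; last exact: h_mono.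
  by apply: contraTT; rewrite -!leNgt le_eqVlt => /orP[/eqP->|/h_mono/ltW->].
split=> // i _.
have [x [Ax ix]] : exists x, A x /\ i <= h x.
  apply: contrapT => no.
  have hi x : A x -> h x < i.
    by move=> Ax; rewrite ltNge; apply/negP => ?; apply: no; exists x.
  have [x0 Ax0 _] := gu i.
  have cA : covers nat A by exact: (covers_inj x0 h_inj hi (init1 i)).
  have [b bP] := succ_card_bounded_set h1 pairing_nat (covers_image g cA).
  have [x Ax bx] := gu b; have := bP (g x) (ex_intro2 _ _ x Ax erefl).
  by rewrite ltNge bx.
have [y [Ay iy] ymin] := 
  @wf_least _ _ [set x | A x /\ i <= h x] wf (ex_intro _ x (conj Ax ix)).
exists y => //; apply/eqP; rewrite eq_le iy andbT.
case: (hP y Ay) => _; apply=> z Az zy; rewrite ltNge; apply/negP => iz.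
exact: ymin (conj Az iz) zy.
Qed.

(** * Sets of order type at most [gamma] *)

Variable gamma : W1.

(** No copy of [gamma + 1]: a form of order type at most [gamma] that passes to
    preimages under increasing maps. *)
Definition short d' (W : orderType d') (B : set W) :=
  ~ exists phi : W1 -> W, (forall i, i <= gamma -> B (phi i)) /\
      (forall i j, i < j -> j <= gamma -> phi i < phi j).

(** An increasing [h \o phi] from [gamma + 1] to [delta <= gamma] would satisfy
    [i <= h (phi i)] for all [i], also for [i = gamma]. *)
Lemma short_otp_le d' (W : orderType d') (B : set W) :
  otp_le B gamma -> short B.
Proof.
move=> [delta dg [h [[hf _ _] hm]]] [phi [phiB phim]].
have le_phi i : i <= gamma -> i <= h (phi i).
  elim/(well_founded_ind wf1): i => i IH ig; rewrite leNgt; apply/negP => lti.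
  have lg := le_trans (ltW lti) ig.
  have : h (phi (h (phi i))) < h (phi i).
    by rewrite hm ?inE; [exact: phim|exact: phiB|exact: phiB].
  by rewrite ltNge (IH _ lti lg).
have := hf _ (phiB _ (lexx gamma)); rewrite /init_seg /= ltNge.
by rewrite (le_trans dg (le_phi _ (lexx _))).
Qed.

(** Induction on [n].  Stack [gamma + 1] intervals each of which escapes every
    [n] short sets.  Another short set cannot meet all of them, since choosing
    one point in each gives a copy of [gamma + 1]; in an interval that it misses
    the induction hypothesis applies. *)
Lemma interval_not_short_cover (n : nat) (b : W1) : exists c : W1,
  forall Bs : seq (set W1), size Bs = n -> (forall B, List.In B Bs -> short B) ->
  exists i, [/\ b <= i, i < c & forall B, List.In B Bs -> ~ B i].
Proof.
elim: n b => [|n IH] b.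
  have [c bc] := succ_card_gt h1 pairing_nat b; exists c => -[|//] _ _.
  by exists b; split.
have [C CP] := choice IH.
have unb (_ : W1) : unbounded [set x | b < x].
  move=> a; have [x] := succ_card_gt h1 pairing_nat (Order.max a b).
  by rewrite gt_max => /andP[ax bx]; exists x.
have [u [ub uC]] := transfinite_seq h1 pairing_nat C wf1 init1 unb.
have [g' gg'] := succ_card_gt h1 pairing_nat gamma.
exists (u g') => -[//|B0 Bs] [sz] Bshort.
have [i ig iB0] : exists2 i, i <= gamma &
    forall x, u i <= x -> x < C (u i) -> ~ B0 x.
  apply: contrapT => no; apply: (Bshort B0); first by left.
  have /choice[phi phiP] : forall i, exists x, i <= gamma ->
      [/\ u i <= x, x < C (u i) & B0 x].
    move=> i; apply: contrapT => no'; apply: no; exists i.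
      by apply: contrapT => ng; apply: no'; exists b => ?.
    by move=> x ux xC Bx; apply: no'; exists x.
  exists phi; split=> [i /phiP[]//|i j ij jg].
  have [_ ? _] := phiP _ (le_trans (ltW ij) jg); have [? _ _] := phiP _ jg.
  by apply: (@lt_trans _ _ (C (u i))) => //; apply: lt_le_trans (uC _ _ ij) _.
have [||x [ux xC xB]] := CP (u i) Bs; first by [].
  by move=> B BB; apply: Bshort; right.
exists x; split.
- exact: le_trans (ltW (ub i)) ux.
- by apply: lt_trans xC _; apply: uC; apply: le_lt_trans ig _.
- by move=> B [<-|/xB//]; exact: iB0.
Qed.

Definition escapes (rho : W1) := forall d' (W : orderType d') (u : W1 -> W)
    (Bs : seq (set W)),
  {homo u : i j / i < j} -> (forall B, List.In B Bs -> short B) ->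
  exists2 i, i < rho & forall B, List.In B Bs -> ~ B (u i).

(** [rho] bounds the right ends of the intervals obtained for all [n]. *)
Lemma short_avoid : exists rho, escapes rho.
Proof.
have [w0] := succ_card_inhabited h1 pairing_nat.
have [c cP] := choice (fun n => interval_not_short_cover n w0).
have [rho rhoP] := succ_card_bounded h1 pairing_nat c.
exists rho => d' W u Bs um Bshort.
have [||i [_ ic iB]] := cP (size Bs) [seq u @^-1` B | B <- Bs].
- by rewrite size_map.
- move=> _ /List.in_map_iff[B [<- /Bshort sB]] [phi [phiB phim]]; apply: sB.
  by exists (u \o phi); split=> // i j ij jg; apply/um/phim.
exists i; first exact: lt_trans ic (rhoP _).
by move=> B BB; apply: (iB (u @^-1` B)); apply/List.in_map_iff; exists B.
Qed.

End Omega1.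

(** * Large subsets of [omega_2] *)

Section Omega2.
Variables (d1 d2 : Order.disp_t) (W1 : orderType d1) (W2 : orderType d2).
Hypothesis h1 : is_omega1 W1.
Hypothesis h2 : is_succ_cardinal W1 W2.

Let p1 : pairing W1 := pairing_omega1 h1.

Definition cof_omega (a : W2) := exists e : nat -> W2,
  (forall n, e n < a) /\ (forall x, x < a -> exists n, x < e n).

(** Stationarity in [omega_2] relative to the points of cofinality [omega]: the
    points closed under a function form a club, and every club contains one of
    these. *)
Definition large (S : set W2) := forall g : W2 -> W2,
  exists a, [/\ S a, cof_omega a & forall x, x < a -> g x < a].

Lemma cof_omega_inhabited a : cof_omega a -> exists x, x < a.
Proof. by move=> [e [ea _]]; exists (e 0%N). Qed.

Lemma large_setT : large [set: W2].
Proof.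
move=> g; have [w0] := succ_card_inhabited h2 p1.
have /choice[G GP] : forall x, exists y, x < y /\ forall z, z <= x -> g z < y.
  move=> x; have [x' xx'] := succ_card_gt h2 p1 x.
  have [y yP] := succ_card_bounded_set h2 p1
    (covers_image g (succ_card_init h2 x')).
  exists (Order.max x' y); split=> [|z zx]; rewrite lt_max ?xx' //.
  by rewrite (yP (g z)) ?orbT //; exists z => //; exact: le_lt_trans xx'.
have [|a [ea aP]] := @increasing_limit _ _ _ h2 p1 (fun n => iter n G w0).
  by move=> n; case: (GP (iter n G w0)).
exists a; split=> //; first by exists (fun n => iter n G w0).
move=> x /aP[n xn]; apply: lt_trans (ea n.+1).
by case: (GP (iter n G w0)) => _; apply; exact: ltW.
Qed.

Lemma large_above S b : large S -> large [set a | S a /\ b < a].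
Proof.
move=> lS g; have [a [Sa ca ga]] := lS (fun x => Order.max (g x) b).
exists a; split=> //; last by move=> x /ga; rewrite gt_max => /andP[].
by split=> //; have [x /ga] := cof_omega_inhabited ca; rewrite gt_max => /andP[].
Qed.

Lemma large_sub (S S' : set W2) : S `<=` S' -> large S -> large S'.
Proof.
by move=> SS lS g; have [a [Sa ca ga]] := lS g; exists a; split=> //; exact: SS.
Qed.

(** The nonstationary ideal is [omega_2]-complete: functions witnessing that
    the [S i] are not large have a common bound [G], by regularity. *)
Lemma large_bigU I (S : I -> set W2) : covers W1 [set: I] ->
  large [set a | exists i, S i a] -> exists i, large (S i).
Proof.
move=> cI lS; apply: contrapT => no.
have /choice[g gP] : forall i, exists g : W2 -> W2,
    forall a, S i a -> cof_omega a -> ~ forall x, x < a -> g x < a.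
  move=> i; apply: contrapT => no'; apply: no; exists i => g.
  apply: contrapT => no''; apply: no'; exists g => a Sa ca ga.
  by apply: no''; exists a.
have /choice[G GP] : forall x, exists y, forall i, g i x < y.
  move=> x; have [y yP] := succ_card_bounded_set h2 p1 (covers_image (g^~ x) cI).
  by exists y => i; apply: yP; exists i.
have [a [[i Sa] ca Ga]] := lS G.
by apply: (gP i a Sa ca) => x xa; exact: lt_trans (GP x i) (Ga x xa).
Qed.

Lemma large_unbounded S b : large S -> exists2 a, S a & b < a.
Proof.
by move=> /(large_above b)/(_ id)[a [[Sa ba] _ _]]; exists a.
Qed.

(** * Countable models *)

Section Hull.
Variables (V : Type) (H : V -> V -> V -> nat -> V).

Inductive hull (X : set V) : V -> Prop :=
| hull_base v : X v -> hull X v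
| hull_app x y z n : hull X x -> hull X y -> hull X z -> hull X (H x y z n).

Lemma hull_mono (X Y : set V) : X `<=` Y -> hull X `<=` hull Y.
Proof.
by move=> XY v; elim=> [w Xw|*]; [apply/hull_base/XY|apply: hull_app].
Qed.

Lemma hull_covers K (X : set V) : pairing K -> covers K X -> covers K (hull X).
Proof.
move=> pK cX.
pose next (L : set V) := L `|`
  [set v | exists x y z n, [/\ L x, L y, L z & v = H x y z n]].
have cnext L : covers K L -> covers K (next L).
  move=> cL; apply: coversU => //; case: cL => v vP.
  have cK := covers_id K; have pKK := covers_prod pK.1.
  have := pKK _ _ cK (pKK _ _ cK (pKK _ _ cK pK.2)).
  move=> /(covers_image (fun p => H (v p.1) (v p.2.1) (v p.2.2.1) p.2.2.2)).
  apply: covers_sub => _ [x [y [z [n [/vP[i <-] /vP[j <-] /vP[k <-] ->]]]]].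
  by exists (i, (j, (k, n))).
have cl n : covers K (iter n next X) by elim: n => //= n; exact: cnext.
apply: covers_sub (covers_bigU pK.1 pK.2 cl) => v.
have lev_mono m n : (m <= n)%N -> iter m next X `<=` iter n next X.
  elim: n => [|n IH]; first by rewrite leqn0 => /eqP->.
  by rewrite leq_eqVlt => /orP[/eqP->//|/IH mn w /mn]; left.
elim=> [w Xw|x y z n _ [i Lx] _ [j Ly] _ [k Lz]]; first by exists 0%N.
exists (maxn i (maxn j k)).+1; right; exists x, y, z, n; split=> //.
- by apply: lev_mono Lx; rewrite leq_maxl.
- by apply: lev_mono Ly; rewrite leq_max leq_maxl orbT.
- by apply: lev_mono Lz; rewrite leq_max leq_maxr orbT.
Qed.

(** A term of the hull of [Y] has finitely many leaves, and these lie in one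
    [X i]. *)
Lemma hull_directed d (I : orderType d) (A : set I) (X : I -> set V) (Y : set V) :
  A !=set0 -> (forall i j, i <= j -> X i `<=` X j) ->
  (forall v, Y v -> exists2 i, A i & X i v) ->
  forall v, hull Y v -> exists2 i, A i & hull (X i) v.
Proof.
move=> [i0 Ai0] Xm YX v; elim=> [w /YX[i Ai Xw]|x y z n _ IHx _ IHy _ IHz].
  by exists i => //; exact: hull_base.
case: IHx => i Ai hx; case: IHy => j Aj hy; case: IHz => k Ak hz.
have [m Am [im jm km]] : exists2 m, A m & [/\ i <= m, j <= m & k <= m].
  have [ij|/ltW ji] := leP i j; [have [jk|/ltW kj] := leP j k|
    have [ik|/ltW ki] := leP i k].
  - by exists k => //; split=> //; exact: le_trans jk.
  - by exists j.
  - by exists k => //; split=> //; exact: le_trans ik.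
  - by exists i.
by exists m => //; apply: hull_app; [move: hx|move: hy|move: hz];
  apply: hull_mono; exact: Xm.
Qed.

Variables (O1 : W1 -> V) (O2 : W2 -> V).
Hypotheses (O1_inj : injective O1) (O2_inj : injective O2).

(** The traces of a countable model on [omega_1] and [omega_2] can be prescribed
    independently.  First choose [beta] in [S] closed under the function [g]
    that bounds the ordinals of the hulls of size [omega_1]; then the hull of
    [W1] and all ordinals below [beta] has no ordinal in [beta] or above.  Now
    the hulls of [i < omega_1] and a fixed [omega]-sequence [e] cofinal in
    [beta] are countable and have supremum [beta], and club many [i] are the
    [omega_1]-part of their hull. *)
Lemma model_exists (S : set W2) (T : set W1) (v0 : nat -> V) :
  large S -> stationary T ->
  exists (delta : W1) (beta : W2) (x : nat -> V),
  [/\ T delta /\ S beta,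
      forall a b c n, range x a -> range x b -> range x c -> range x (H a b c n),
      range v0 `<=` range x,
      forall i, range x (O1 i) <-> i < delta
    & (forall y, range x (O2 y) -> y < beta) /\
      (forall y, y < beta -> exists2 z, range x (O2 z) & y < z)].
Proof.
move=> lS sT.
have pN := pairing_nat.
have [w1] := succ_card_inhabited h1 pN; have [w2] := succ_card_inhabited h2 p1.
have c11 := covers_id W1.
pose X (D : set W2) := range O1 `|` (range v0 `|` O2 @` D).
have /choice[g gP] : forall a, exists b, forall y,
    hull (X [set z | z <= a]) (O2 y) -> y < b.
  move=> a; have [a' aa'] := succ_card_gt h2 p1 a.
  apply: (succ_card_bounded_set h2 p1).
  apply: (covers_inj w2 (fun y z _ _ => @O2_inj y z) (fun y h => h)).
  apply: hull_covers => //; apply: coversU => //; first exact: covers_image.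
  apply: coversU => //; first exact: covers_image p1.2.
  apply: covers_image; apply: covers_sub (succ_card_init h2 a') => z /= za.
  exact: le_lt_trans aa'.
have [beta [Sb cb gb]] := lS g.
have hullb y : hull (X (init_seg beta)) (O2 y) -> y < beta.
  suff main : forall v, hull (X (init_seg beta)) v ->
      exists2 a, a < beta & hull (X [set z | z <= a]) v.
    by move=> /main[a ab /gP/lt_trans]; apply; exact: gb.
  apply: hull_directed; first exact: cof_omega_inhabited.
    move=> a b ab v [|[|[z za <-]]]; [by left|by right; left|].
    by right; right; exists z => //; exact: le_trans ab.
  have [b0 b0b] := cof_omega_inhabited cb.
  move=> v [vO|[vv|[z zb <-]]].
  - by exists b0 => //; left.
  - by exists b0 => //; right; left.
  - by exists z => //; right; right; exists z => /=.
have [e [eb ecof]] := cb.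
(* [Y i] generates the candidate with [omega_1]-part [i]. *)
pose Y (i : W1) := O1 @` init_seg i `|` (range v0 `|` range (O2 \o e)).
have YX i : hull (Y i) `<=` hull (X (init_seg beta)).
  apply: hull_mono => v [[j _ <-]|[vv|[n _ <-]]].
  - by left; exists j.
  - by right; left.
  - by right; right; exists (e n); first exact: eb.
have cY i : covers nat (hull (Y i)).
  apply: hull_covers => //; apply: coversU => //.
    by apply: covers_image; exact: (succ_card_init h1).
  by apply: coversU => //; apply: covers_image => //; exact: pN.2.
have Y_dir (A : set W1) a : A !=set0 ->
    (forall j, j < a -> exists2 i, A i & j < i) ->
    forall v, hull (Y a) v -> exists2 i, A i & hull (Y i) v.
  move=> [i0 Ai0] Aa; apply: hull_directed; first by exists i0.
    move=> i j ij v [[k ki <-]|]; last by right.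
    by left; exists k => //; exact: lt_le_trans ij.
  move=> v [[j /Aa[i Ai ji] <-]|]; last by exists i0 => //; right.
  by exists i => //; left; exists j.
pose C := [set i | forall j, hull (Y i) (O1 j) -> j < i].
have clubC : club C.
  split.
    move=> a [[a0 a0a] alim] [aub alub] _ j.
    have dir k : k < a -> exists2 i, C i /\ i < a & k < i.
      move=> ka; apply: contrapT => no.
      have : a <= k.
        apply: alub => i [Ci ia]; rewrite leNgt; apply/negP => ki.
        by apply: no; exists i.
      by rewrite leNgt ka.
    have [i0 Ai0 _] := dir _ a0a.
    move=> /(Y_dir [set i | C i /\ i < a] a (ex_intro _ i0 Ai0) dir).
    by move=> [i [Ci ia] /Ci ji]; exact: lt_trans ia.
  move=> a.
  have /choice[nx nxP] : forall i, exists i', i < i' /\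
      forall j, hull (Y i) (O1 j) -> j < i'.
    move=> i; have [b bP] := succ_card_bounded_set h1 pN
      (covers_inj w1 (fun y z _ _ => @O1_inj y z) (fun y h => h) (cY i)).
    have [c ic] := succ_card_gt h1 pN (Order.max i b).
    move: ic; rewrite gt_max => /andP[ic bc].
    by exists c; split=> // j /bP/lt_trans; apply.
  have [|b [ab bP]] := @increasing_limit _ _ _ h1 pN (fun n => iter n nx a).
    by move=> n; case: (nxP (iter n nx a)).
  exists b; last exact: (ab 0%N).
  move=> j /(Y_dir (range (fun n => iter n nx a))) [].
  - by exists a, 0%N.
  - by move=> k /bP[n kn]; exists (iter n nx a) => //; exists n.
  - move=> _ [n _ <-] hj; apply: lt_trans (ab n.+1).
    by case: (nxP (iter n nx a)) => _; apply.
have [delta [Td Cd]] := sT C clubC.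
have hY0 : hull (Y delta) (v0 0%N) by apply: hull_base; right; left; exists 0%N.
have [v vP] := cY delta.
pose x n := if `[< hull (Y delta) (v n) >] then v n else v0 0%N.
have rx : range x = hull (Y delta).
  apply/seteqP; split=> [_ [n _ <-]|w hw].
    by rewrite /x; case: asboolP.
  have [n nE] := vP w hw; exists n => //; rewrite /x nE.
  by case: asboolP.
exists delta, beta, x; rewrite rx; split=> //.
- by move=> a b c n; exact: hull_app.
- by move=> w vw; apply: hull_base; right; left.
- move=> i; split=> [|id]; first exact: Cd.
  by apply: hull_base; left; exists i.
- split=> [y /YX/hullb//|y /ecof[n yn]].
  by exists (e n) => //; apply: hull_base; right; right; exists n.
Qed.
End Hull.
End Omega2.

(** * Rainbow sequences *)

Lemma In_map S T (g : S -> T) (s : seq S) y :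
  List.In y [seq g x | x <- s] <-> exists2 x, List.In x s & y = g x.
Proof.
elim: s => [|a s IH] /=; first by split=> // -[].
split=> [[<-|/(proj1 IH)[x xs ->]]|[x [->|xs] E]].
- by exists a => //; left.
- by exists x => //; right.
- by left.
- by right; apply: (proj2 IH); exists x.
Qed.

Lemma In_mem (T : eqType) (x : T) s : List.In x s <-> x \in s.
Proof.
elim: s => [|a s IH] //=; rewrite inE; split=> [[->|/IH->]|/orP[/eqP->|/IH]].
- by rewrite eqxx.
- by rewrite orbT.
- by left.
- by right.
Qed.

Lemma In_cat_split T (x : T) (s : seq T) : List.In x s ->
  exists s1 s2, s = s1 ++ x :: s2.
Proof. exact: List.in_split. Qed.

Section Free.
Variables (d1 d2 : Order.disp_t) (W1 : orderType d1) (W2 : orderType d2).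
Variable f : set W2 -> W2.

Definition free z (l : seq W2) := uniq [seq f [set y; z] | y <- l].

(** [Z] and [l] stand for the upper and lower parts of a decreasing sequence;
    the test is made at the elements of [Z] only. *)
Fixpoint free_over (Z l : seq W2) : bool :=
  if Z is z :: Z' then free z (Z' ++ l) && free_over Z' l else true.

Definition decr_rainbow l := free_over l [::].

Lemma free_over_cat Z l : decr_rainbow (Z ++ l) = free_over Z l && decr_rainbow l.
Proof. by rewrite /decr_rainbow; elim: Z => //= z Z ->; rewrite cats0 andbA. Qed.

(** The classes to be avoided by a point inserted between [Z] and [l]. *)
Fixpoint clashes (Z l : seq W2) : seq (set W2) :=
  if Z is z :: Z' then [seq t_set f y z | y <- Z' ++ l] ++ clashes Z' l
  else [::].

Lemma free_over_cons Z l x : (forall z, z \in Z -> x < z) ->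
  (forall B, List.In B (clashes Z l) -> ~ B x) ->
  free_over Z l -> free_over Z (x :: l).
Proof.
elim: Z => //= z Z IH xZ xB /andP[fz fZ]; apply/andP; split; last first.
  apply: IH => // [y yZ|B BZ]; first by apply: xZ; rewrite inE yZ orbT.
  by apply: xB; apply/List.in_app_iff; right.
rewrite /free -cat1s map_cat map_cat uniq_catCA -map_cat /= [uniq _]fz andbT.
apply/negP => /mapP[y yZ E]; apply: (xB (t_set f y z)).
  by apply/List.in_app_iff; left; apply/In_map; exists y => //; apply/In_mem.
by split=> //; apply: xZ; rewrite inE eqxx.
Qed.

Lemma free_inj z l x y : free z l -> x \in l -> y \in l ->
  f [set x; z] = f [set y; z] -> x = y.
Proof.
elim: l => //= a l IH /andP[/negP na ul]; rewrite !inE.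
move=> /orP[/eqP->|xl] /orP[/eqP->//|yl] E; last exact: IH.
  by case: na; rewrite E; apply/mapP; exists y.
by case: na; rewrite -E; apply/mapP; exists x.
Qed.

Lemma decr_rainbow_inj l m x y : decr_rainbow l -> sorted >%O l ->
  m \in l -> x \in l -> y \in l -> x < m -> y < m ->
  f [set x; m] = f [set y; m] -> x = y.
Proof.
rewrite /decr_rainbow; elim: l => //= a l IH /andP[fa /IH{}IH].
rewrite path_sortedE; last exact: rev_trans lt_trans.
move=> /andP[/allP la /IH{}IH]; rewrite cats0 in fa.
rewrite !inE; have [->|ma] /= := eqVneq m a => [_|ml].
  move=> + + xa ya; rewrite (lt_eqF xa) (lt_eqF ya) /= => xl yl E.
  exact: free_inj fa _ _ E.
by move=> + + xm ym; rewrite (lt_eqF (lt_trans xm (la _ ml)))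
  (lt_eqF (lt_trans ym (la _ ml))) /= => xl yl; exact: IH.
Qed.

Lemma pairs_max (A : set W2) u : pairs A u ->
  exists x m, [/\ A x, A m, x < m, u = [set x; m] & is_max u m].
Proof.
move=> [x [y [Ax Ay xy ->]]]; move: xy.
have mx a b : a < b -> is_max [set a; b] b.
  by move=> ab; split; [right|move=> _ [->|->] //; exact: ltW].
rewrite neq_lt => /orP[xy|yx].
  by exists x, y; split=> //; exact: mx.
by exists y, x; rewrite setUC; split=> //; exact: mx.
Qed.

Variable gamma : W1.
Hypothesis ht : forall a b : W2, a < b -> otp_le (t_set f a b) gamma.
Hypothesis h1 : is_omega1 W1.

Lemma clashes_short Z l : sorted >%O Z ->
  (forall y z, y \in l -> z \in Z -> y < z) ->
  forall B, List.In B (clashes Z l) -> short gamma B.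
Proof.
elim: Z => //= z Z IH; rewrite path_sortedE; last exact: rev_trans lt_trans.
move=> /andP[/allP Zz /IH{}IH] lZ B /List.in_app_iff[/In_map[y /In_mem yl ->]|].
  apply/(short_otp_le h1)/ht; move: yl; rewrite mem_cat => /orP[/Zz//|yl].
  by apply: lZ => //; rewrite inE eqxx.
by apply: IH => x y xl yZ; apply: lZ => //; rewrite inE yZ orbT.
Qed.
End Free.

(** * The universe of models *)

Section Universe.
Variables (d1 d2 : Order.disp_t) (W1 : orderType d1) (W2 : orderType d2).

(** A fragment of a structure [H(theta)] that is just rich enough: ordinals
    below [omega_1] and [omega_2], relations on finite sequences of ordinals,
    such sequences, models, and conditions.  A model [Node delta beta x] is the
    countable set [range x]; [delta] and [beta] are intended to be the suprema
    of its [omega_1]- and [omega_2]-parts. *)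
Inductive univ :=
| O1 of W1
| O2 of W2
| Rel of set (seq W2)
| Tup of seq W2
| Nod of node
| Con of seq (node * W2)
with node := Node of W1 & W2 & (nat -> univ).

Definition height m := let: Node i _ _ := m in i.
Definition peak m := let: Node _ a _ := m in a.
Definition elts m := let: Node _ _ x := m in x.
Definition model m : set univ := range (elts m).

(** Sequences grow at the head, which is the largest element. *)
Definition derived (F : set (seq W2)) : set (seq W2) :=
  [set t | unbounded [set x | F (x :: t)]].

(** The part of elementarity that matters.  In [valid_elem], a bound for
    [{x | F (x :: t)}] would be definable in the model, hence below its peak. *)
Record valid (m : node) : Prop := Valid {
  valid_elem : forall F t, model m (Rel F) -> model m (Tup t) ->
    F (peak m :: t) -> derived F t;
  valid_derived : forall F, model m (Rel F) -> model m (Rel (derived F));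
  valid_nil : model m (Tup [::]);
  valid_cons : forall x t, model m (O2 x) -> model m (Tup t) ->
    model m (Tup (x :: t));
  valid_lt : forall x, model m (O2 x) -> x < peak m;
  valid_cofinal : forall y, y < peak m -> exists2 z, model m (O2 z) & y < z;
  valid_node : forall m', model m (Nod m') ->
    [/\ model m (O2 (peak m')), height m' < height m & model m' `<=` model m]
}.

Definition peaks (s : seq (node * W2)) := [seq peak x.1 | x <- s].

(** [y] may stand under [x] in a condition.  Since the decoration [y.2] belongs
    to the model of [x], it lies below the peak of [x]. *)
Definition below (y x : node * W2) := model x.1 (Nod y.1) /\ model x.1 (O2 y.2).

Fixpoint chain (s : seq (node * W2)) : Prop :=
  if s is x :: s' then
    [/\ valid x.1, (forall y, List.In y s' -> below y x) & chain s']
  else True.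

Lemma chain_cat s s' : chain (s ++ s') <->
  [/\ chain s, chain s' & forall x y, List.In x s -> List.In y s' -> below y x].
Proof.
elim: s => [|a s IH] /=; first by split=> // -[].
split=> [[va ba /IH[cs cs' b]]|[[va ba cs] cs' b]].
  split=> //; first by split=> // y ys; apply: ba; apply/List.in_app_iff; left.
  move=> x y [<-|xs] ys; last exact: b.
  by apply: ba; apply/List.in_app_iff; right.
split=> //.
  by move=> y /List.in_app_iff[/ba//|ys]; apply: b => //; left.
by apply/IH; split=> // x y xs ys; apply: b => //; right.
Qed.

Lemma chain_valid s x : chain s -> List.In x s -> valid x.1.
Proof. by elim: s => //= a s IH [va _ cs] [<-//|/IH]; exact. Qed.

Lemma below_lt y x : valid x.1 -> below y x ->
  [/\ peak y.1 < peak x.1, y.2 < peak x.1 & height y.1 < height x.1].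
Proof.
move=> vx [/(valid_node vx)[yx hyx _] dyx].
by split=> //; apply: valid_lt.
Qed.

Lemma chain_total s x y : chain s -> List.In x s -> List.In y s ->
  [\/ x = y, below x y | below y x].
Proof.
elim: s => //= a s IH [_ ba cs] [<-|xs] [<-|ys]; [by constructor 1| | |exact: IH].
- by constructor 3; exact: ba.
- by constructor 2; exact: ba.
Qed.

Lemma chain_sorted s : chain s -> sorted >%O (peaks s).
Proof.
elim: s => //= x s IH [vx bx /IH ss].
rewrite path_sortedE ?ss ?andbT; last exact: rev_trans lt_trans.
apply/allP => _ /In_mem/In_map[y ys ->].
by have [] := below_lt vx (bx y ys).
Qed.

End Universe.

(** * Models closed under Skolem functions *)

Section Skolem.
Variables (d1 d2 : Order.disp_t) (W1 : orderType d1) (W2 : orderType d2).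
Hypothesis h1 : is_omega1 W1.
Hypothesis h2 : is_succ_cardinal W1 W2.
Notation univ := (univ W1 W2).
Notation node := (node W1 W2).

(** [E b q c] reads: [q] lies in the [b]-th of the dense sets under
    consideration, as witnessed by [c]. *)
Variables (E : W1 -> seq (node * W2) -> W1 -> Prop).

(** The sequences of peaks of the end-extensions of [s] that lie in the [b]-th
    dense set: a relation on ordinals, so it may belong to a model. *)
Definition shapes s b : set (seq W2) :=
  [set t | exists top c, peaks top = t /\ E b (top ++ s) c].

Record skolem_closed (m : node) : Prop := SkolemClosed {
  sk_ord : forall i, model m (O1 W2 i) <-> i < height m;
  sk_limit : forall i, i < height m -> exists2 j, i < j & j < height m;
  sk_shapes : forall s b, model m (Con s) -> b < height m ->
    model m (Rel _ (shapes s b));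
  sk_seq : forall F t, model m (Rel _ F) -> model m (Tup _ t) -> derived F t ->
    exists u : W1 -> W2, {homo u : i j / i < j} /\ forall i,
      F (u i :: t) /\ (i < height m -> model m (O2 _ (u i)));
  sk_pick : forall s b t, model m (Con s) -> b < height m -> model m (Tup _ t) ->
    shapes s b t -> exists top c,
      [/\ peaks top = t, E b (top ++ s) c, model m (Con (top ++ s)) & c < height m];
  sk_nil : model m (Con [::]);
  sk_cons : forall s m' d, model m (Con s) -> model m (Nod m') ->
    model m (O2 _ d) -> model m (Con ((m', d) :: s));
  sk_in : forall s x, model m (Con s) -> List.In x s -> below x (m, peak m)
}.

(** All closure requirements are met by a single Skolem function [sk], to which
    [model_exists] is applied. *)
Lemma node_exists (S : set W2) (T : set W1) (s0 : seq (node * W2)) (i0 : W1) :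
  large S -> stationary T -> exists m : node,
  [/\ T (height m) /\ S (peak m), valid m, skolem_closed m,
      model m (Con s0) & i0 < height m].
Proof.
move=> lS sT; have p1 := pairing_omega1 h1.
have [w0] := succ_card_inhabited h2 p1.
have /choice[succ succP] := succ_card_gt h1 pairing_nat.
have /choice[bd bdP] : forall Ft : set (seq W2) * seq W2, exists b,
    ~ derived Ft.1 Ft.2 -> forall x, Ft.1 (x :: Ft.2) -> x <= b.
  move=> [F t] /=; case: (pselect (derived F t)) => [?|nd]; first by exists w0.
  have /existsNP[b bP] := nd; exists b => _ x Fx; rewrite leNgt; apply/negP => bx.
  by apply: bP; exists x.
have /choice[inc incP] : forall Ft : set (seq W2) * seq W2, exists u : W1 -> W2,
    derived Ft.1 Ft.2 -> {homo u : i j / i < j} /\ forall i, Ft.1 (u i :: Ft.2).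
  move=> [F t] /=; case: (pselect (derived F t)) => [dF|?]; last by exists (fun=> w0).
  have cW1 (i : W1) := covers_sub (@subsetT _ (init_seg i)) (covers_id W1).
  have [u [uF uM]] := transfinite_seq h2 p1 id (succ_card_wf h1) cW1 (fun _ => dF).
  by exists u => _; split=> // i j; exact: uM.
have /choice[pick pickP] : forall sbt : seq (node * W2) * W1 * seq W2,
    exists tc : seq (node * W2) * W1, shapes sbt.1.1 sbt.1.2 sbt.2 ->
    peaks tc.1 = sbt.2 /\ E sbt.1.2 (tc.1 ++ sbt.1.1) tc.2.
  move=> [[s b] t] /=; case: (pselect (shapes s b t)) => [[top [c h]]|?].
    by exists (top, c).
  by exists ([::], b).
pose sk (x y z : univ) (n : nat) : univ := match x, y, z with
  | Rel F, Tup t, O1 i => O2 _ (inc (F, t) i)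
  | Rel F, Tup t, _ => O2 _ (bd (F, t))
  | Rel F, _, _ => Rel _ (derived F)
  | Con s, O1 b, Tup t =>
      if n is 0 then Con ((pick (s, b, t)).1 ++ s) else O1 _ (pick (s, b, t)).2
  | Con s, O1 b, _ => Rel _ (shapes s b)
  | Con s, Nod m, O2 d => Con ((m, d) :: s)
  | Con s, _, _ => if s is a :: s' then
      match n with 0 => Nod a.1 | 1 => O2 _ a.2 | _ => Con s' end else x
  | Nod m, _, _ =>
      match n with 0 => O1 _ (height m) | 1 => O2 _ (peak m) | n.+2 => elts m n end
  | O1 i, _, _ => O1 _ (succ i)
  | O2 a, Tup t, _ => Tup _ (a :: t)
  | _, _, _ => x
  end.
(* The elements that the model must contain beforehand. *)
pose v0 n : univ := match n with
  0 => Con s0 | 1 => Con [::] | 2 => Tup _ [::] | _ => O1 _ i0 end.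
have O1_inj : injective (O1 (W1 := W1) W2) by move=> i j [].
have O2_inj : injective (O2 W1 (W2 := W2)) by move=> i j [].
have [delta [beta [x [TS skx v0x ordx [ltx cofx]]]]] :=
  model_exists h1 h2 sk O1_inj O2_inj v0 lS sT.
pose m := Node delta beta x; exists m.
have seed n : model m (v0 n) by apply: v0x; exists n.
have mem_in s y : model m (Con s) -> List.In y s -> below y (m, beta).
  elim: s => //= a s IH ms [<-|]; last exact: IH (skx _ _ _ 2 ms ms ms).
  by split; [exact: (skx _ _ _ 0 ms ms ms)|exact: (skx _ _ _ 1 ms ms ms)].
split=> //; [| |exact: (seed 0%N)|exact/ordx/(seed 3)].
- split.
  + move=> F t mF mt Fm; apply: contrapT => nd.
    have := ltx _ (skx _ _ _ 0 mF mt mF).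
    by rewrite ltNge (bdP (F, t) nd _ Fm).
  + by move=> F mF; exact: (skx _ _ _ 0 mF mF mF).
  + exact: (seed 2).
  + by move=> y t my mt; exact: (skx _ _ _ 0 my mt mt).
  + by [].
  + by [].
  + move=> m' mm'; split.
    * exact: (skx _ _ _ 1 mm' mm' mm').
    * exact/ordx/(skx _ _ _ 0 mm' mm' mm').
    * by move=> _ [n _ <-]; exact: (skx _ _ _ n.+2 mm' mm' mm').
- split=> //.
  + move=> i /ordx mi; exists (succ i); first exact: succP.
    exact/ordx/(skx _ _ _ 0 mi mi mi).
  + by move=> s b ms /ordx mb; exact: (skx _ _ _ 0 ms mb mb).
  + move=> F t mF mt dF; exists (inc (F, t)); have [incm incF] := incP (F, t) dF.
    split=> // i; split=> [|/ordx mi]; [exact: incF|exact: (skx _ _ _ 0 mF mt mi)].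
  + move=> s b t ms /ordx mb mt sh; have [? ?] := pickP (s, b, t) sh.
    exists (pick (s, b, t)).1, (pick (s, b, t)).2; split=> //.
      exact: (skx _ _ _ 0 ms mb mt).
    exact/ordx/(skx _ _ _ 1 ms mb mt).
  + exact: (seed 1%N).
  + by move=> s m' d ms mm' md; exact: (skx _ _ _ 0 ms mm' md).
Qed.
End Skolem.

(** * Conditions and reflection into a model *)

Section Conditions.
Variables (d1 d2 : Order.disp_t) (W1 : orderType d1) (W2 : orderType d2).
Hypothesis h1 : is_omega1 W1.
Hypothesis h2 : is_succ_cardinal W1 W2.
Variables (f : set W2 -> W2) (gamma : W1).
Hypothesis ht : forall a b : W2, a < b -> otp_le (t_set f a b) gamma.

Local Notation node := (node W1 W2).

Definition is_cond (s : seq (node * W2)) :=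
  [/\ chain s, decr_rainbow f (peaks s) & large [set z | free f z (peaks s)]].

Lemma peaks_cat (s s' : seq (node * W2)) : peaks (s ++ s') = peaks s ++ peaks s'.
Proof. exact: map_cat. Qed.

Lemma seq_bounded (w0 : W2) (l : seq W2) : exists b, forall y, y \in l -> y <= b.
Proof.
elim: l => [|a l [b bP]]; first by exists w0.
exists (Order.max a b) => y; rewrite inE le_max => /orP[/eqP->|/bP->].
  by rewrite lexx.
by rewrite orbT.
Qed.

Section Reflection.
Variables (rho : W1).
Hypothesis rhoP : escapes gamma rho.

Variable D : W1 -> seq (node * W2) -> W1 -> Prop.
Let E b q c := is_cond q /\ D b q c.

Variables (m : node).
Hypotheses (vm : valid m) (skm : skolem_closed E m) (rhom : rho < height m).

Lemma model_Con d s : (forall y, List.In y s -> below y (m, d)) -> model m (Con s).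
Proof.
elim: s => [_|[m' d'] s IH bs]; first exact: sk_nil skm.
have [Nm Om] := bs (m', d') (or_introl erefl).
by apply: (sk_cons skm) => //; apply: IH => y ys; apply: bs; right.
Qed.

Lemma model_derived F k : model m (Rel _ F) -> model m (Rel _ (iter k (@derived _ W2) F)).
Proof. by move=> mF; elim: k => //= k; exact: valid_derived. Qed.

(** At each model of [top ++ [:: (m, d)]], from the highest down, [valid_elem]
    replaces the peak of that model by unboundedly many points; the relation
    stays in [model m], which is included in all the others. *)
Lemma descend d s top F : chain (top ++ (m, d) :: s) -> model m (Rel _ F) ->
  F (peaks top ++ [:: peak m]) -> iter (size top).+1 (@derived _ W2) F [::].
Proof.
elim: top F => [|x top IH] F /=.
  by move=> _ mF; apply: (valid_elem vm) => //; exact: valid_nil.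
move=> [vx bx ct] mF Fx; rewrite -[X in X [::]]/(iter (size top).+2 (@derived _ W2) F).
rewrite iterSr.
apply: IH => //; first exact: valid_derived.
have mx : model m `<=` model x.1.
  have [|Nm _] := bx (m, d); first by apply/List.in_app_iff; right; left.
  by have [] := valid_node vx Nm.
apply: (valid_elem vx) => //; first exact: mx.
have : forall y, List.In y (top ++ [:: (m, d)]) -> model x.1 (O2 _ (peak y.1)).
  move=> y yt; have [|Ny _] := bx y; last by have [] := valid_node vx Ny.
  by move: yt => /List.in_app_iff[yt|[<-|//]]; apply/List.in_app_iff; [left|right; left].
rewrite -[peaks top ++ _]/(peaks top ++ peaks [:: (m, d)]) -peaks_cat.
elim: (top ++ _) => /= [|y l IHl yl]; first by move=> _; exact: valid_nil.
by apply: (valid_cons vx); [apply: yl; left|apply: IHl => z zl; apply: yl; right].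
Qed.

(** Converse to [descend], inside the model [m]: a point of a sequence with
    unboundedly many successors is extended by one of the first [rho] members of
    an increasing sequence of successors.  These belong to [m] because
    [rho < height m], and one of them avoids the clashes with [Z]. *)
Lemma ascend Z low k F t :
  sorted >%O Z -> (forall z, z \in Z -> peak m <= z) ->
  (forall y, y \in t ++ low -> y < peak m) ->
  model m (Rel _ F) -> model m (Tup _ t) -> iter k (@derived _ W2) F t ->
  free_over f Z (t ++ low) ->
  exists t', [/\ F t', model m (Tup _ t') & free_over f Z (t' ++ low)].
Proof.
move=> sZ mZ; elim: k t => [|k IH] t tm mF mt /= Ft fZ; first by exists t.
have [u [um uF]] := sk_seq skm (model_derived k mF) mt Ft.
have [|i ir iB] := rhoP (Bs := clashes f Z (t ++ low)) um.
  by apply: (clashes_short ht h1) => // y z /tm ym /mZ; exact: lt_le_trans.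
have [Fu] := uF i; move=> /(_ (lt_trans ir rhom)) mu.
have um' := valid_lt vm mu.
apply: (IH (u i :: t)) => //.
- by move=> y; rewrite inE => /orP[/eqP->//|/tm].
- exact: valid_cons.
- by apply: free_over_cons => // z /mZ; exact: lt_le_trans.
Qed.

(** Genericity of [m].  A condition through [m] that lies in the [b]-th dense
    set has the part [s] below [m]; the finite sequence of its other peaks is
    moved into [m] by [descend] and [ascend], and [mid ++ s] realizes it. *)
Lemma reflect_below d top s b c :
  b < height m -> is_cond (top ++ (m, d) :: s) -> D b (top ++ (m, d) :: s) c ->
  exists mid c', [/\ D b (mid ++ s) c', is_cond (mid ++ s),
    is_cond (top ++ (m, d) :: mid ++ s) & c' < height m].
Proof.
set r := top ++ _ => bm cr Dr; have [chr rr lr] := cr.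
have p1 := pairing_omega1 h1; have [w0] := succ_card_inhabited h2 p1.
have [cht [_ bs chs] btop] := (chain_cat top ((m, d) :: s)).1 chr.
have ms := model_Con bs.
pose F := shapes E s b; have mF : model m (Rel _ F) := sk_shapes skm ms bm.
have FF : F (peaks top ++ [:: peak m]).
  by exists (top ++ [:: (m, d)]), c; rewrite peaks_cat -catA.
have dF := descend chr mF FF.
pose Z := peaks top ++ [:: peak m].
have peaks_r : peaks r = Z ++ peaks s by rewrite /r peaks_cat /Z -catA.
have sr := chain_sorted chr.
have sZ : sorted >%O Z.
  by move: sr; rewrite peaks_r => /cat_sorted2[].
have [w wP] := seq_bounded w0 Z.
have Zm z : z \in Z -> peak m <= z.
  rewrite mem_cat inE => /orP[/In_mem/In_map[x xt ->]|/eqP-> //].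
  have [] := below_lt (chain_valid cht xt) (btop _ _ xt (or_introl erefl)).
  by move=> /ltW.
have sm y : y \in peaks s -> y < peak m.
  by move=> /In_mem/In_map[x xs ->]; have [] := below_lt (x := (m, d)) vm (bs _ xs).
(* [S n] gathers the [z] for which the [n]-th element of [m] is a good branch. *)
pose S n := [set z | exists t, [/\ elts m n = Tup _ t, F t &
  free_over f (z :: Z) (t ++ peaks s)]].
(* The bound [w] puts [z] above all of [Z], which has the largest peaks. *)
have : large [set z | exists n, S n z].
  apply: large_sub (large_above w lr) => z [fz wz].
  have [|||||t [Ft [n _ nt] ft]] := @ascend (z :: Z) (peaks s) _ F [::] _ _ _ mF _ dF.
  - rewrite /= path_sortedE ?sZ ?andbT; last exact: rev_trans lt_trans.
    by apply/allP => y /wP yw; exact: le_lt_trans wz.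
  - move=> y; rewrite inE => /orP[/eqP->|/Zm//].
    apply: ltW; apply: le_lt_trans wz; apply: wP.
    by rewrite mem_cat inE eqxx orbT.
  - exact: sm.
  - exact: valid_nil.
  - move: rr fz; rewrite /= peaks_r free_over_cat => /andP[fZ _] fz.
    by apply/andP; split.
  by exists n, t.
move=> /(large_bigU h1 h2 p1.2)[n lS].
have [z0 [t [nt Ft _]] _] := large_unbounded w0 lS.
have mt : model m (Tup _ t) by exists n.
have [mid [c' [midt [cmid Dmid] mmid c'm]]] := sk_pick skm ms bm mt Ft.
exists mid, c'; split=> //.
have [chm rm _] := cmid.
have peaks_e : peaks (top ++ (m, d) :: mid ++ s) = Z ++ (t ++ peaks s).
  by rewrite peaks_cat /= peaks_cat midt /Z -catA.
split.
- apply/chain_cat; split=> //.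
    by split=> // y yms; exact: (sk_in skm mmid).
  move=> x y xt [<-|yms]; first by apply: btop => //; left.
  have vx := chain_valid cht xt.
  have [Nm _] := btop x (m, d) xt (or_introl erefl).
  have [_ _ mx] := valid_node vx Nm.
  by have [/mx ? /mx ?] := sk_in skm mmid yms.
- move: (rm); rewrite peaks_e free_over_cat peaks_cat midt => ->.
  case: (large_unbounded w0 lS) => z [t' [nt' _]].
  by move: nt'; rewrite nt => -[<-] /= /andP[_ ->].
- apply: large_sub lS => z [t' [nt' _]]; move: nt'; rewrite nt => -[<-].
  by rewrite /= peaks_e => /andP[].
Qed.
End Reflection.
End Conditions.

(** * The forcing preserves stationary sets *)

Section Forcing.
Variables (d1 d2 : Order.disp_t) (W1 : orderType d1) (W2 : orderType d2).
Hypothesis h1 : is_omega1 W1.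
Hypothesis h2 : is_succ_cardinal W1 W2.
Variables (f : set W2 -> W2) (gamma : W1).
Hypothesis ht : forall a b : W2, a < b -> otp_le (t_set f a b) gamma.

Local Notation node := (node W1 W2).

(** Unboundedly many [z] in the large set of [p] are peaks of suitable models.
    Fix [omega_1] many of them: for each larger [z] in the large set, one of them
    can be added below [z], and by completeness one of them works for a large
    set of [z]. *)
Lemma add_top (E : W1 -> seq (node * W2) -> W1 -> Prop) (T : set W1) p i0 :
  stationary T -> is_cond f p -> exists m : node,
  [/\ T (height m), is_cond f ((m, peak m) :: p), valid m, skolem_closed E m
    & i0 < height m].
Proof.
move=> sT [cp rp lp]; have p1 := pairing_omega1 h1.
have [w0] := succ_card_inhabited h2 p1.
(* [Q i b]: [b] is the peak of a model fit to be put on top of [p]. *)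
pose Q (_ : W1) b := exists m, [/\ T (height m) /\ free f (peak m) (peaks p),
  peak m = b, valid m, skolem_closed E m & model m (Con p) /\ i0 < height m].
have Q_unb i : unbounded (Q i).
  move=> b; have [m [[Tm [fm bm]] vm sm pm im]] :=
    node_exists h1 h2 E p i0 (large_above b lp) sT.
  by exists (peak m) => //; exists m.
have cW1 (i : W1) := covers_sub (@subsetT _ (init_seg i)) (covers_id W1).
have [u [uQ um]] := transfinite_seq h2 p1 id (succ_card_wf h1) cW1 Q_unb.
have {}um : {homo u : i j / i < j} by move=> i j; exact: um.
have [rho rhoP] := short_avoid h1 gamma.
have [b ub] := succ_card_bounded h2 p1 u.
have [b' pb] := seq_bounded w0 (peaks p).
have : large [set z | exists i, free f z (u i :: peaks p)].
  apply: large_sub (large_above b (large_above b' lp)) => z [[fz bz] b'z].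
  have [|i _ iB] := rhoP _ _ u (clashes f [:: z] (peaks p)) um.
    apply: (clashes_short ht h1) => // y x /pb yb; rewrite inE => /eqP->.
    exact: le_lt_trans bz.
  exists i; have : free_over f [:: z] (u i :: peaks p).
    apply: free_over_cons => //; last by rewrite /= fz.
    by move=> x; rewrite inE => /eqP->; exact: lt_trans (ub i) _.
  by rewrite /= andbT.
move=> /(large_bigU h1 h2 (covers_id W1))[i li].
have [m [[Tm fm] mE vm sm [pm im]]] := uQ i.
exists m; split=> //; split=> //=.
- by split=> // y yp; exact: (sk_in sm pm).
- by apply/andP; split; rewrite ?cats0.
- by move: li; rewrite -mE.
Qed.

Definition cond := {s : seq (node * W2) | is_cond f s}.

(** Decorations may be raised. *)
Definition stronger (q p : cond) := forall x, List.In x (sval p) ->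
  exists2 d, x.2 <= d & List.In (x.1, d) (sval q).

Lemma stronger_refl p : stronger p p.
Proof. by move=> [m d] xp; exists d. Qed.

Lemma stronger_trans p q r : stronger p q -> stronger q r -> stronger p r.
Proof.
move=> pq qr x /qr[d xd /pq[d' /= dd' ?]]; exists d' => //; exact: le_trans dd'.
Qed.

Lemma f_mem_stronger a (N : nice_name cond W1) p q :
  stronger q p -> f_mem stronger a N p -> f_mem stronger a N q.
Proof. by move=> qp mp r rq; apply: mp; exact: stronger_trans qp. Qed.

Lemma forcing_notion_cond : forcing_notion stronger.
Proof.
split; [|exact: stronger_refl|exact: stronger_trans].
constructor; exists [::]; split=> //.
by apply: large_sub (large_setT h1 h2) => z.
Qed.

(** Below [q'] the name has elements cofinal in [height m]: whenever a condition
    decides such an element above [b < height m], [reflect_below] provides a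
    compatible one that decides an element below [height m]. *)
Lemma cond_preserves_stationary : preserves_stationary stronger W1.
Proof.
move=> T sT p0 N q qp0 [clN unbN] q1 q1q.
have [rho rhoP] := short_avoid h1 gamma.
pose D b s c := b < c /\ exists2 p : cond, sval p = s & f_mem stronger c N p.
have [m [Tm cm vm sm rm]] :=
  add_top (fun b s c => is_cond f s /\ D b s c) rho sT (svalP q1).
pose q' : cond := exist _ _ cm.
have q'q1 : stronger q' q1 by move=> [m' d] xq; exists d => //; right.
exists q' => //; exists (height m) => //.
have q'q := stronger_trans q'q1 q1q.
apply: (clN (height m)) => //.
  by split; [exists rho|move=> b /(sk_limit sm)[c bc cm']; exists c].
move=> b bm r0 r0q'.
have [r [c bc rc] rr0] := unbN b Logic.I r0 (stronger_trans r0q' q'q).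
have [|d _ /= mr] := @stronger_trans _ _ _ rr0 r0q' (m, peak m); first by left.
have [top [s rE]] := In_cat_split mr.
have cr := svalP r; rewrite rE in cr.
have [|mid [c' [[bc' [p pE pc']] cmid ce c'm]]] :=
  reflect_below h1 h2 ht rhoP (D := D) vm sm rm (b := b) (c := c) bm cr.
  by split=> //; exists r.
pose e : cond := exist _ _ ce.
exists e; last first.
  apply: (stronger_trans _ rr0) => -[m' d']; rewrite rE => xr; exists d' => //=.
  move: xr => /List.in_app_iff[xr|[xr|xr]]; apply/List.in_app_iff.
  - by left.
  - by right; left.
  - by right; right; apply/List.in_app_iff; right.
exists c'; first by split.
apply: f_mem_stronger pc' => -[m' d']; rewrite pE => xp; exists d' => //=.
by apply/List.in_app_iff; right; right.
Qed.

End Forcing.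

(** * The generic set *)

Section Generic.
Variables (d1 d2 : Order.disp_t) (W1 : orderType d1) (W2 : orderType d2).
Hypothesis h1 : is_omega1 W1.
Hypothesis h2 : is_succ_cardinal W1 W2.
Variables (f : set W2 -> W2) (gamma : W1).
Hypothesis hf : normal_coloring [set: W2] f.
Hypothesis ht : forall a b : W2, a < b -> otp_le (t_set f a b) gamma.

Local Notation node := (node W1 W2).
Local Notation cond := (@cond _ _ W1 W2 f).
Local Notation stronger := (@stronger _ _ W1 W2 f).

Definition reaches (i : W1) : set cond :=
  [set p | exists2 x, List.In x (sval p) & i < height x.1].

(** Indexing models by their height keeps the family of dense sets of size
    [omega_1]. *)
Definition skips (j : W1) (n : nat) : set cond :=
  [set p | exists x y, [/\ List.In x (sval p), List.In y (sval p),
    height x.1 = j, height y.1 < j & forall w, elts x.1 n = O2 _ w -> w <= y.2]].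

(** Dense whatever [A] is. *)
Definition decides (A : set cond) : set cond :=
  [set p | A p \/ forall q, stronger q p -> ~ A q].

Lemma dense_decides A : dense stronger (decides A).
Proof.
move=> p; case: (pselect (exists2 q, stronger q p & A q)) => [[q qp Aq]|no].
  by exists q => //; left.
exists p; last exact: stronger_refl.
by right=> q qp Aq; apply: no; exists q.
Qed.

Lemma stationary_setT : stationary [set: W1].
Proof.
move=> C [_ unbC]; have [w0] := succ_card_inhabited h1 pairing_nat.
by have [b Cb _] := unbC w0; exists b.
Qed.

Lemma dense_reaches i : dense stronger (reaches i).
Proof.
move=> p; have [m [_ cm _ _ im]] :=
  add_top h1 h2 ht (fun _ _ _ => True) i stationary_setT (svalP p).
exists (exist _ _ cm); first by exists (m, peak m) => //; left.
by move=> [m' d] xp; exists d => //; right.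
Qed.

(** If some model lies under [m] in [p], the decoration of the highest of these
    can be raised up to any ordinal of [m]: decorations are compared with the
    models above only, and all those contain the ordinals of [m]. *)
Lemma raise_decoration (p : cond) (m m0 : node) d d0 a :
  List.In (m, d) (sval p) -> List.In (m0, d0) (sval p) ->
  height m0 < height m -> model m (O2 _ a) ->
  exists q : cond, stronger q p /\ exists m1 d1,
    [/\ List.In (m1, d1) (sval q), height m1 < height m & a <= d1].
Proof.
move=> mp m0p m0m ma; have [cp rp lp] := svalP p.
have [top [s pE]] := In_cat_split mp.
case: s pE => [|[m1 e] s] pE.
  have := m0p; rewrite pE => /List.in_app_iff[m0t|[[E _]|//]].
    have ct : chain (top ++ [:: (m, d)]) by rewrite -pE.
    have [_ _ bt] := (chain_cat _ _).1 ct.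
    have [_ _] := below_lt (chain_valid cp m0p) (bt _ _ m0t (or_introl erefl)).
    by move=> /lt_trans/(_ m0m); rewrite ltxx.
  by move: m0m; rewrite E ltxx.
pose s' := top ++ (m, d) :: (m1, Order.max e a) :: s.
have ps' : peaks s' = peaks (sval p) by rewrite pE !peaks_cat.
move: (cp); rewrite pE => /chain_cat[ct [vm bm [vm1 bm1 cs]] btop].
have eI : List.In (m1, e) ((m1, e) :: s) by left.
have mE : model m (O2 _ (Order.max e a)).
  by have [_ me] := bm _ eI; rewrite /Order.max; case: ifP.
have cs' : is_cond f s'.
  rewrite /is_cond ps'; split=> //; apply/chain_cat; split=> //.
    split=> // y [<-|ys]; last by apply: bm; right.
    by split=> //; have [] := bm _ eI.
  move=> x y xt [<-|[<-|ys]]; [by apply: btop => //; left| |].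
    have [N1 _] := btop x (m1, e) xt (or_intror eI).
    have [Nm _] := btop x (m, d) xt (or_introl erefl).
    have vx := chain_valid ct xt; have [_ _ mx] := valid_node vx Nm.
    by split=> //; exact: mx.
  by apply: btop => //; right; right.
exists (exist _ _ cs'); split.
  move=> x; rewrite pE => /List.in_app_iff[xt|[xE|[xE|xs]]].
  - by exists x.2 => //; case: x xt => ? ? xt; apply/List.in_app_iff; left.
  - by exists d; rewrite -?xE //; apply/List.in_app_iff; right; left.
  - exists (Order.max e a); rewrite -?xE /= ?le_max ?lexx //.
    by apply/List.in_app_iff; right; right; left.
  - exists x.2 => //; case: x xs => ? ? xs.
    by apply/List.in_app_iff; right; right; right.
exists m1, (Order.max e a); split.
- by apply/List.in_app_iff; right; right; left.
- by have [] := below_lt (x := (m, d)) vm (bm _ eI).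
- by rewrite le_max lexx orbT.
Qed.

Variable G : set cond.
Hypothesis filterG : is_filter stronger G.
Hypothesis G_reaches : forall i, G `&` reaches i !=set0.
Hypothesis G_skips : forall j n, G `&` decides (skips j n) !=set0.

Definition in_G (x : node * W2) := exists2 p, G p & List.In x (sval p).

Lemma in_G_common x y : in_G x -> in_G y -> exists p dx dy,
  [/\ G p, x.2 <= dx, y.2 <= dy, List.In (x.1, dx) (sval p)
    & List.In (y.1, dy) (sval p)].
Proof.
move=> [p Gp xp] [q Gq yq]; have [_ _ /(_ _ _ Gp Gq)[r [Gr rp rq]]] := filterG.
have [dx xdx xr] := rp _ xp; have [dy ydy yr] := rq _ yq.
by exists r, dx, dy.
Qed.

Lemma in_G_trichotomy x y : in_G x -> in_G y ->
  [\/ x.1 = y.1,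
      [/\ peak x.1 < peak y.1, x.2 < peak y.1 & height x.1 < height y.1] |
      [/\ peak y.1 < peak x.1, y.2 < peak x.1 & height y.1 < height x.1]].
Proof.
move=> xG yG; have [p [dx [dy [_ xdx ydy xp yp]]]] := in_G_common xG yG.
have [cp _ _] := svalP p.
have [[-> _]|b|b] := chain_total cp xp yp; first by constructor 1.
  have [? h ?] := below_lt (chain_valid cp yp) b.
  by constructor 2; split=> //; exact: le_lt_trans h.
have [? h ?] := below_lt (chain_valid cp xp) b.
by constructor 3; split=> //; exact: le_lt_trans h.
Qed.

Definition generic_set : set W2 := [set a | exists2 x, in_G x & peak x.1 = a].

(** Let [x] be the model with the least peak not below [a], and suppose that its
    peak exceeds [a].  It contains some [c > a], and the filter decides whether
    a lower model gets a decoration at least [c].  If not, [raise_decoration]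
    gives a contradiction.  If so, that lower model has peak below [a], and the
    peaks between it and [a] would exceed [c]. *)
Lemma generic_set_closed : closed_ord generic_set.
Proof.
move=> a [[w wa] _] [aub alub] [b0 gb0 ab0].
have cof c : c < a -> exists2 x, in_G x & c < peak x.1 /\ peak x.1 < a.
  move=> ca; apply: contrapT => no.
  have : a <= c.
    apply: alub => _ [[x xG <-] xa]; rewrite leNgt; apply/negP => cx.
    by apply: no; exists x.
  by rewrite leNgt ca.
have [|_ [[x xG <-] ax] xmin] := @wf_least _ _ (generic_set `&` [set b | a <= b])
    (succ_card_wf h2).
  by exists b0; split=> //=; exact: ltW.
move: ax; rewrite /= le_eqVlt => /orP[/eqP->|ax]; first by exists x.
have vx : valid x.1 by case: xG => p _ xp; have [/chain_valid/(_ xp)] := svalP p.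
have [c mc ac] := valid_cofinal vx ax.
have [n _ nc] := mc.
have [p [Gp [|no]]] := G_skips (height x.1) n; last first.
  have [x0 x0G [_ x0a]] := cof w wa.
  have x0x : height x0.1 < height x.1.
    have := lt_trans x0a ax.
    have [->|[_ _ //]|[xx0 _ _]] := in_G_trichotomy x0G xG; first by rewrite ltxx.
    by move=> /(lt_trans xx0); rewrite ltxx.
  have [p' [d [d0 [Gp' _ _ xp' x0p']]]] := in_G_common xG x0G.
  have [_ _ /(_ _ _ Gp Gp')[r [Gr rp rp']]] := filterG.
  have [d' _ /= xr] := rp' _ xp'; have [d0' _ /= x0r] := rp' _ x0p'.
  have [q [qr [m1 [e1 [m1q m1x cd1]]]]] := raise_decoration xr x0r x0x mc.
  have [d'' _ /= xq] := qr _ xr.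
  case: (no q); first exact: stronger_trans rp.
  exists (x.1, d''), (m1, e1); split=> // z /=.
  by rewrite nc => -[<-].
move=> [x' [y [x'p yp x'x yx yc]]].
have x'G : in_G x' by exists p.
have yG : in_G y by exists p.
have x'E : x'.1 = x.1.
  have [//|[_ _]|[_ _]] := in_G_trichotomy x'G xG; by rewrite x'x ltxx.
have {}yc : c <= y.2 by apply: yc; rewrite x'E.
have ya : peak y.1 < a.
  rewrite ltNge; apply/negP => ay; apply: (xmin (peak y.1)).
    by split=> //; exists y.
  have [E|[]//|[_ _ xy]] := in_G_trichotomy yG xG.
    by move: yx; rewrite E ltxx.
  by have := lt_trans yx xy; rewrite ltxx.
have [z zG [yz za]] := cof _ ya.
have [E|[_ + _]|[zy _ _]] := in_G_trichotomy yG zG.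
- by move: yz; rewrite E ltxx.
- by move=> /(le_lt_trans yc)/(lt_trans ac)/lt_trans/(_ za); rewrite ltxx.
- by have := lt_trans yz zy; rewrite ltxx.
Qed.

Lemma generic_set_rainbow : rainbow f generic_set.
Proof.
move=> u v /set_mem pu /set_mem pv fuv.
have [_ [_ [[x xG <-] [m mG <-] xm uE um]]] := pairs_max pu.
have [_ [_ [[y yG <-] [m' m'G <-] ym vE vm]]] := pairs_max pv.
have T w : pairs generic_set w -> pairs setT w.
  by move=> [a [b [_ _ ab wE]]]; exists a, b.
have E := hf (T _ pu) (T _ pv) fuv um vm; rewrite -E in ym vE.
have [p [dx [dy [Gp _ _ xp yp]]]] := in_G_common xG yG.
have [q Gq mq] := mG.
have [_ _ /(_ _ _ Gp Gq)[r [Gr rp rq]]] := filterG.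
have [cr rr _] := svalP r.
have mem (z : node * W2) s : stronger r s -> List.In z (sval s) ->
    peak z.1 \in peaks (sval r).
  move=> rs /rs[d _ zr]; apply/In_mem/In_map; by exists (z.1, d).
rewrite uE vE; congr [set _; _].
apply: (decr_rainbow_inj rr (chain_sorted cr) (mem _ _ rq mq)
  (mem _ _ rp xp) (mem _ _ rp yp) xm ym).
by rewrite -uE -vE.
Qed.

Lemma generic_set_otp : same_otp generic_set [set: W1].
Proof.
have [w0] := succ_card_inhabited h1 pairing_nat.
have /choice[g gP] : forall a, exists i, forall x, in_G x -> peak x.1 = a ->
    height x.1 = i.
  move=> a; case: (pselect (generic_set a)) => [[x xG xa]|no]; last first.
    by exists w0 => x xG xa; case: no; exists x.
  exists (height x.1) => y yG ya; have [->//|[+ _ _]|[+ _ _]] := in_G_trichotomy xG yG.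
    by rewrite xa ya ltxx.
  by rewrite xa ya ltxx.
apply: (same_otp_omega1 h1 (g := g)); first exact: (succ_card_wf h2).
  move=> _ _ /set_mem[x xG <-] /set_mem[y yG <-] xy.
  rewrite -(gP _ _ xG erefl) -(gP _ _ yG erefl).
  have [E|[]//|[yx _ _]] := in_G_trichotomy xG yG; first by move: xy; rewrite E ltxx.
  by have := lt_trans xy yx; rewrite ltxx.
move=> i; have [p [Gp [x xp ix]]] := G_reaches i.
have xG : in_G x by exists p.
by exists (peak x.1); [exists x|rewrite -(gP _ _ xG erefl); exact: ltW].
Qed.

End Generic.

Theorem theorem5p1 (d1 d2 : Order.disp_t)
  (W1 : orderType d1) (W2 : orderType d2)
  (h2 : is_omega2 W1 W2)
  (MM : Martins_Maximum W1)
  (f : set W2 -> W2) (hf : normal_coloring [set: W2] f)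
  (ht : exists gamma : W1,
     forall a b : W2, a < b -> otp_le (t_set f a b) gamma) :
  exists A : set W2,
    [/\ closed_ord A, rainbow f A & same_otp A [set: W1]].
Proof.
have [h1 hW2] := h2; have [gamma {}ht] := ht.
have [e eP] := omega1_covers_nat h1.
(* One sequence of length [omega_1] lists both families of dense sets. *)
pose D i : set (cond W1 f) := if (e i).2 is n.+1 then decides (skips (e i).1 n)
  else reaches (e i).1.
have denseD i : dense (@stronger _ _ W1 W2 f) (D i).
  rewrite /D; case: (e i).2 => [|n]; last exact: dense_decides.
  exact: (dense_reaches h1 hW2 ht).
have [G filterG GD] := MM _ _ (forcing_notion_cond h1 hW2 f)
  (cond_preserves_stationary h1 hW2 ht) D denseD.
have G_reaches i : G `&` reaches i !=set0.
  by have [j jE] := eP (i, 0%N) Logic.I; have := GD j; rewrite /D jE.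
have G_skips j n : G `&` decides (skips j n) !=set0.
  by have [k kE] := eP (j, n.+1) Logic.I; have := GD k; rewrite /D kE.
exists (generic_set G); split.
- exact: (generic_set_closed h2.2 filterG G_skips).
- exact: (generic_set_rainbow hf filterG).
- exact: (generic_set_otp h1 hW2 filterG G_reaches).
Qed.
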